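(* Let $L\in\{0,1\}^{n\times n}$ be an adjacency matrix with exactly $k$ nonzero rows, $1\le k<n$, let $0<\xi<1$, and let $H=\xi LL^T+\frac{1-\xi}{n}ee^T\in\mathbb{R}^{n\times n}$. Let $P$ be a permutation matrix such that $$PLP^T=\begin{bmatrix}L_{11}&L_{12}\\0&0\end{bmatrix},\qquad L_{11}\in\mathbb{R}^{k\times k},\quad L_{12}\in\mathbb{R}^{k\times(n-k)}.$$ Let $$X=\begin{bmatrix}I_k&0\\0&Y\end{bmatrix},\quad Y=I_{n-k}-\widehat{e}e_1^T,\quad \widehat{e}=e-e_1=\begin{bmatrix}0&1&\cdots&1\end{bmatrix}^T\in\mathbb{R}^{n-k}.$$ Then $$XPHP^TX^{-1}=\begin{bmatrix}H^{(1)}&H^{(2)}\\0&0\end{bmatrix},$$ where $$H^{(1)}=\begin{bmatrix}H^{(1)}_{11}&\frac{1-\xi}{n}(n-k)e\\ \frac{1-\xi}{n}e^T&\frac{1-\xi}{n}(n-k)\end{bmatrix}\in\mathbb{R}^{(k+1)\times(k+1)},\qquad H^{(1)}_{11}=\xi(L_{11}L_{11}^T+L_{12}L_{12}^T)+\frac{1-\xi}{n}ee^T\in\mathbb{R}^{k\times k},$$ $$H^{(2)}=\begin{bmatrix}\frac{1-\xi}{n}ee^TY^{-1}\begin{bmatrix}e_2&\cdots&e_{n-k}\end{bmatrix}\\ \frac{1-\xi}{n}e^TY^{-1}\begin{bmatrix}e_2&\cdots&e_{n-k}\end{bmatrix}\end{bmatrix}\in\mathbb{R}^{(k+1)\times(n-k-1)}.$$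 Moreover, $H^{(1)}$ has the same nonzero eigenvalues as $H$.
   Context: $L$ is the adjacency matrix of a web graph on $n$ pages: $L_{ij}=1$ if page $i$ links to page $j$, and $L_{ij}=0$ otherwise. A page with no outlinks (a zero row of $L$) is called dangling; otherwise it is nondangling, and $k$ is the number of nondangling pages. The matrix $H$ is called the hub matrix. Throughout, $e$ denotes the column vector of all ones of whatever length the context requires, $I_m$ is the identity matrix of order $m$, and $e_1,\dots,e_{n-k}$ are the columns of $I_{n-k}$. In $H^{(1)}$, the vectors $e$ in the off-diagonal blocks have length $k$; in the top block of $H^{(2)}$, $ee^T$ is the $k\times(n-k)$ all-ones matrix, and in the bottom block $e^T$ has length $n-k$. If $n-k=1$, the block $H^{(2)}$ and the zero rows are empty. *)

(* Defs.v *)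
From HB Require Import structures.
From mathcomp Require Import all_boot all_order all_algebra reals complex.

Set Implicit Arguments.
Unset Strict Implicit.
Unset Printing Implicit Defensive.

Import Order.TTheory GRing.Theory Num.Theory.
Local Open Scope ring_scope.

(* Matrices of order n are built here from blocks of size k and n - k, or     *)
(* k + 1 and n - k - 1; these equalities serve to cast them back to 'M_n.     *)
Lemma dangling_split n k : (k < n)%N -> (k + (n - k))%N = n.
Proof. by move=> /ltnW; exact: subnKC. Qed.

Lemma lumped_split n k : (k < n)%N -> ((k + 1) + (n - k - 1))%N = n.
Proof. by move=> kn; rewrite addn1 -subnDA addn1 subnKC. Qed.

Section HubLumping.
Variable R : realType.

Definition is_adjacency n (L : 'M[R]_n) : Prop :=
  forall i j, L i j = 0 \/ L i j = 1.

Definition num_nondangling n (L : 'M[R]_n) : nat :=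
  #|[set i | row i L != 0]|.

Definition ones m : 'cV[R]_m := const_mx 1.

Definition hub_matrix n (xi : R) (L : 'M[R]_n) : 'M[R]_n :=
  xi *: (L *m L^T) + ((1 - xi) / n%:R) *: (ones n *m (ones n)^T).

(* The paper's e_1, written without requiring m to be a successor.            *)
Definition e_first m : 'cV[R]_m := \col_i (nat_of_ord i == 0)%N%:R.

Definition e_hat m : 'cV[R]_m := ones m - e_first m.

(* The matrix [e_2 ... e_m]; columns are indexed from 0, so that column j is  *)
(* the basis vector with its 1 in (0-based) row j + 1.                        *)
Definition e_rest m : 'M[R]_(m, m - 1) :=
  \matrix_(i, j) (nat_of_ord i == j.+1)%N%:R.

Definition Ymx m : 'M[R]_m := 1%:M - e_hat m *m (e_first m)^T.

Definition Xmx n k (kn : (k < n)%N) : 'M[R]_n :=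
  castmx (dangling_split kn, dangling_split kn)
    (block_mx 1%:M 0 0 (Ymx (n - k))).

Definition H1_11 n k (xi : R) (L11 : 'M[R]_k) (L12 : 'M[R]_(k, n - k)) :
    'M[R]_k :=
  xi *: (L11 *m L11^T + L12 *m L12^T)
  + ((1 - xi) / n%:R) *: (ones k *m (ones k)^T).

Definition H1 n k (xi : R) (L11 : 'M[R]_k) (L12 : 'M[R]_(k, n - k)) :
    'M[R]_(k + 1) :=
  block_mx
    (H1_11 xi L11 L12)
    (((1 - xi) / n%:R * (n - k)%:R) *: ones k)
    (((1 - xi) / n%:R) *: (ones k)^T)
    ((1 - xi) / n%:R * (n - k)%:R)%:M.

Definition H2 n k (xi : R) : 'M[R]_(k + 1, n - k - 1) :=
  col_mx
    (((1 - xi) / n%:R) *: (ones k *m (ones (n - k))^T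
                            *m invmx (Ymx (n - k)) *m e_rest (n - k)))
    (((1 - xi) / n%:R) *: ((ones (n - k))^T
                            *m invmx (Ymx (n - k)) *m e_rest (n - k))).

End HubLumping.

Definition complexify (R : realType) p q (A : 'M[R]_(p, q)) : 'M[R[i]]_(p, q) :=
  map_mx (real_complex R) A.

(* Equality of the nonzero complex spectra, counted with algebraic            *)
(* multiplicity.                                                              *)
Definition same_nonzero_eigenvalues (R : realType) p q
    (A : 'M[R]_p) (B : 'M[R]_q) : Prop :=
  forall lambda : R[i], lambda != 0 ->
    eigenvalue (complexify A) lambda = eigenvalue (complexify B) lambda /\
    mup lambda (char_poly (complexify A)) = mup lambda (char_poly (complexify B)).

(* Main.v *)
Require Import Defs.
From HB Require Import structures.
From mathcomp Require Import all_boot all_order all_algebra reals complex.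
From mathcomp Require Import fingroup perm.

(** The congruence by [P] replaces [L] by its block form in the hub matrix,
    because the all-ones matrix is invariant under permutations
    ([hub_matrix_perm]).  The dangling pages contribute nothing to [L L^T], so
    in the permuted hub matrix every block other than the leading one is
    a multiple of an all-ones matrix ([hub_matrix_block]).

    The elimination matrix [Y] sends [e] to [e_1] ([Ymx_ones]).  Hence
    multiplying on the left by [X] concentrates the rows of the dangling pages
    in a single one, and the rows below it vanish.  On the right, the row
    [e^T Y^-1] occurs, whose first entry is [e^T Y^-1 e_1 = e^T e = n - k],
    by the same identity read backwards; its other entries are the ones which
    [H2] names ([lumped_form]).  Re-bracketing [k + (1 + q)] as [(k + 1) + q]
    gives the announced block triangular form.

    The equality of the nonzero spectra follows: the characteristic polynomial
    is invariant under similarity, and that of a block matrix with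
    zero lower rows is that of its leading block times a power of ['X], a factor
    without nonzero roots. *)

Set Implicit Arguments.
Unset Strict Implicit.
Unset Printing Implicit Defensive.

Import Order.TTheory GRing.Theory Num.Theory.
Local Open Scope ring_scope.

(** * Characteristic polynomials *)

(** The scalar matrix ['X] commutes with the lift of [X] to polynomial entries, so
    the characteristic matrices of [A] and [X A X^-1] are conjugate. *)
Lemma char_poly_conjmx (R : comUnitRingType) n (X A : 'M[R]_n) :
  X \in unitmx -> char_poly (X *m A *m invmx X) = char_poly A.
Proof.
move=> Xu; pose X' := map_mx polyC X; pose V' := map_mx polyC (invmx X).
have XV : X' *m V' = 1%:M by rewrite -map_mxM mulmxV // map_mx1.
have -> : char_poly (X *m A *m invmx X) = \det (X' *m char_poly_mx A *m V').
  rewrite /char_poly /char_poly_mx !map_mxM mulmxBr mulmxBl.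
  by rewrite (scalar_mxC _ X') -(mulmxA _%:M) XV mulmx1.
by rewrite !det_mulmx mulrAC -det_mulmx XV det1 mul1r.
Qed.

Lemma char_poly_castmx (R : comNzRingType) m n (e : m = n) (A : 'M[R]_m) :
  char_poly (castmx (e, e) A) = char_poly A.
Proof. by case: n / e; rewrite castmx_id. Qed.

Lemma char_poly_block0 (R : comNzRingType) p q (A : 'M[R]_p) (B : 'M[R]_(p, q)) :
  char_poly (block_mx A B 0 0) = char_poly A * 'X^q.
Proof.
rewrite /char_poly /char_poly_mx map_block_mx !map_mx0 scalar_mx_block.
by rewrite opp_block_mx add_block_mx !oppr0 !addr0 det_ublock det_scalar.
Qed.

(** The factor ['X^r] does not change the multiplicity of [lambda != 0],
    and characteristic polynomials commute with the embedding into [R[i]]. *)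
Lemma same_nonzero_eigenvalues_char_poly (R : realType) p q r
    (A : 'M[R]_p) (B : 'M[R]_q) :
  char_poly B = char_poly A * 'X^r -> same_nonzero_eigenvalues A B.
Proof.
move=> AB lambda lambda_neq0.
have ABC : char_poly (complexify B) = char_poly (complexify A) * 'X^r.
  by rewrite -!map_char_poly AB rmorphM /= map_polyXn.
have Xr : ~~ root ('X^r : {poly R[i]}) lambda.
  by rewrite rootE hornerXn expf_eq0 negb_and lambda_neq0 orbT.
by rewrite !eigenvalue_root_char ABC mupMl // rootM (negPf Xr) orbF.
Qed.

(** * Permuted hub matrices *)

Section Hub.
Variable R : realType.

Lemma perm_mx_ones n (s : 'S_n) : perm_mx s *m ones R n = ones R n.
Proof. by rewrite -row_permE /row_perm; apply/matrixP => i j; rewrite !mxE. Qed.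

Lemma ones_mul_tr m : (ones R m)^T *m ones R m = m%:R%:M.
Proof.
apply/matrixP => i j; rewrite !mxE !ord1 eqxx mulr1n.
under eq_bigr do rewrite !mxE mulr1.
by rewrite sumr_const card_ord.
Qed.

Lemma invmx_is_perm n (P : 'M[R]_n) :
  is_perm_mx P -> P \in unitmx /\ P^T = invmx P.
Proof.
case/is_perm_mxP => s ->; have su : perm_mx s \in unitmx := unitmx_perm R s.
split=> //; rewrite -[LHS]mulmx1 -(mulmxV su) mulmxA tr_perm_mx.
by rewrite -perm_mxM mulVg perm_mx1 mul1mx.
Qed.

Lemma hub_matrix_perm n xi (L P : 'M[R]_n) : is_perm_mx P ->
  P *m hub_matrix xi L *m P^T = hub_matrix xi (P *m L *m P^T).
Proof.
move=> Pperm; have [Pu PV] := invmx_is_perm Pperm.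
have Pe : P *m ones R n = ones R n.
  by case/is_perm_mxP: Pperm => s ->; exact: perm_mx_ones.
rewrite /hub_matrix mulmxDr mulmxDl -!scalemxAr -!scalemxAl; congr (_ + _).
  congr (_ *: _); rewrite !trmx_mul trmxK !mulmxA; congr (_ *m _ *m _).
  by rewrite PV mulmxKV.
by rewrite mulmxA Pe -mulmxA -trmx_mul Pe.
Qed.

Lemma hub_matrix_block k m xi (L11 : 'M[R]_k) (L12 : 'M[R]_(k, m)) :
  let c := (1 - xi) / (k + m)%:R in
  hub_matrix xi (block_mx L11 L12 0 0) =
  block_mx
    (xi *: (L11 *m L11^T + L12 *m L12^T) + c *: (ones R k *m (ones R k)^T))
    (c *: (ones R k *m (ones R m)^T))
    (c *: (ones R m *m (ones R k)^T)) (c *: (ones R m *m (ones R m)^T)).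
Proof.
move=> c; rewrite /hub_matrix -/c.
have -> : ones R (k + m) = col_mx (ones R k) (ones R m) by rewrite /ones col_mx_const.
rewrite tr_block_mx mulmx_block !trmx0 !mulmx0 !mul0mx !addr0.
rewrite tr_col_mx mul_col_row !scale_block_mx add_block_mx.
by rewrite !scaler0 !add0r.
Qed.

(** * The elimination matrix *)

(** The columns [e_2 ... e_m] with their number [q] kept independent of [m]:
    for [q = m - 1] this is convertible to [e_rest], and for [m = 1 + q] the
    index types match the block decomposition of [m]. *)
Definition e_rest_cols m q : 'M[R]_(m, q) :=
  \matrix_(i, j) (nat_of_ord i == j.+1)%N%:R.

Lemma e_first_block q : e_first R (1 + q) = col_mx 1%:M 0.
Proof.
apply/matrixP => i j; rewrite !mxE ord1.
by case: splitP => i' ->; rewrite !mxE ?ord1.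
Qed.

Lemma e_rest_cols_block q : e_rest_cols (1 + q) q = col_mx 0 1%:M.
Proof.
apply/matrixP => i j; rewrite !mxE.
by case: splitP => i' ->; rewrite !mxE ?ord1.
Qed.

Lemma row_mx_e_first_rest p q (v : 'M[R]_(p, 1 + q)) :
  v = row_mx (v *m e_first R (1 + q)) (v *m e_rest_cols (1 + q) q).
Proof.
rewrite e_first_block e_rest_cols_block -{1 2 3}[v]hsubmxK !mul_row_col.
by rewrite !mulmx1 !mulmx0 addr0 add0r.
Qed.

Lemma e_first_tr_ones q : (e_first R (1 + q))^T *m ones R (1 + q) = 1%:M.
Proof.
rewrite e_first_block /ones -col_mx_const tr_col_mx mul_row_col.
rewrite trmx1 trmx0 mul1mx mul0mx addr0.
by apply/matrixP => i j; rewrite !mxE !ord1.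
Qed.

Lemma e_first_tr_e_hat q : (e_first R (1 + q))^T *m e_hat R (1 + q) = 0.
Proof.
rewrite mulmxBr e_first_tr_ones e_first_block tr_col_mx mul_row_col.
by rewrite trmx1 trmx0 mul1mx mul0mx addr0 subrr.
Qed.

(** The square of [N = e_hat e_1^T] is zero because the first entry of [e_hat]
    is, so [1 + N] inverts [Y = 1 - N]. *)
Lemma Ymx_unit q : Ymx R (1 + q) \in unitmx.
Proof.
set N := e_hat R (1 + q) *m (e_first R (1 + q))^T.
have NN : N *m N = 0.
  by rewrite mulmxA -(mulmxA _ _^T) e_first_tr_e_hat mulmx0 mul0mx.
suff: Ymx R (1 + q) *m (1%:M + N) = 1%:M by case/mulmx1_unit.
by rewrite mulmxDr mulmx1 mulmxBl mul1mx NN subr0 subrK.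
Qed.

(** The property for which [Y] is designed: it subtracts the first dangling page
    from all the others. *)
Lemma Ymx_ones q : Ymx R (1 + q) *m ones R (1 + q) = e_first R (1 + q).
Proof.
by rewrite mulmxBl mul1mx -mulmxA e_first_tr_ones mulmx1 subKr.
Qed.

(** * The lumped form *)

Section Blocks.
Variables (k q : nat).
Local Notation m := (1 + q)%N.
Local Notation Y := (Ymx R m).
Local Notation X := (block_mx (1%:M : 'M[R]_k) 0 0 Y).

Lemma invmx_block_diag1 (Z : 'M[R]_m) : Z \in unitmx ->
  block_mx (1%:M : 'M[R]_k) 0 0 Z \in unitmx
  /\ invmx (block_mx (1%:M : 'M[R]_k) 0 0 Z) = block_mx 1%:M 0 0 (invmx Z).
Proof.
move=> Zu; set B := block_mx _ _ _ _.
have BV : B *m block_mx 1%:M 0 0 (invmx Z) = 1%:M.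
  rewrite mulmx_block !mulmx0 !mul0mx !mulmx1 !addr0 add0r mulmxV //.
  by rewrite -scalar_mx_block.
have [Bu _] := mulmx1_unit BV; split=> //.
by rewrite -[LHS]mulmx1 -BV mulKmx.
Qed.

(** The entry at [e_1] is computed by replacing [e_1] with [Y e]. *)
Lemma ones_tr_invY :
  (ones R m)^T *m invmx Y
  = row_mx m%:R%:M ((ones R m)^T *m invmx Y *m e_rest_cols m q).
Proof.
rewrite [LHS]row_mx_e_first_rest; congr row_mx.
by rewrite -[e_first R m]Ymx_ones mulmxA mulmxKV ?Ymx_unit // ones_mul_tr.
Qed.

Lemma lumped_form (A : 'M[R]_k) c (e : (k + 1 + q)%N = (k + m)%N) :
  X *m block_mx A (c *: (ones R k *m (ones R m)^T))
         (c *: (ones R m *m (ones R k)^T)) (c *: (ones R m *m (ones R m)^T))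
    *m invmx X
  = castmx (e, e) (block_mx
      (block_mx A ((c * m%:R) *: ones R k) (c *: (ones R k)^T) (c * m%:R)%:M)
      (col_mx (c *: (ones R k *m (ones R m)^T *m invmx Y *m e_rest_cols m q))
              (c *: ((ones R m)^T *m invmx Y *m e_rest_cols m q)))
      0 0).
Proof.
have [_ ->] := invmx_block_diag1 (Ymx_unit q).
rewrite !mulmx_block !mul0mx !mulmx0 !mulmx1 !mul1mx !addr0 !add0r.
rewrite -!scalemxAr -!scalemxAl !mulmxA Ymx_ones.
rewrite -!(mulmxA _ (ones R m)^T) ones_tr_invY.
set w := _ *m e_rest_cols m q.
have wE : row_mx m%:R%:M w *m e_rest_cols m q = w by rewrite -ones_tr_invY.
rewrite -mulmxA wE.
rewrite e_first_block mul_col_row mul_col_mx !mul_mx_row !mul1mx !mul0mx.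
rewrite mul_mx_scalar scale_col_mx scale_row_mx scale_block_mx.
rewrite !scaler0 scalerA scale_scalar_mx.
(* The first dangling page moves from the second diagonal block to the first. *)
have := @block_mxA R k 1 q k 1 q A ((c * m%:R) *: ones R k) (c *: (ones R k *m w))
  (c *: (ones R k)^T) (c * m%:R)%:M (c *: w) 0 0 0.
rewrite /= row_mx0 => ->.
exact: eq_castmx.
Qed.

End Blocks.

(** The identities between dimensions enter as arbitrary equations, so that they
    can be eliminated, and the casts with them. *)
Lemma hub_lumping n k m q (ekm : (k + m)%N = n) (ekq : (k + 1 + q)%N = n)
    (emq : m = (1 + q)%N) xi (L P : 'M[R]_n)
    (L11 : 'M[R]_k) (L12 : 'M[R]_(k, m)) :
  is_perm_mx P ->
  P *m L *m P^T = castmx (ekm, ekm) (block_mx L11 L12 0 0) ->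
  let c := (1 - xi) / n%:R in
  let X := castmx (ekm, ekm) (block_mx 1%:M 0 0 (Ymx R m)) in
  [/\ Ymx R m \in unitmx, X \in unitmx
    & X *m P *m hub_matrix xi L *m P^T *m invmx X =
      castmx (ekq, ekq) (block_mx
        (block_mx
          (xi *: (L11 *m L11^T + L12 *m L12^T) + c *: (ones R k *m (ones R k)^T))
          ((c * m%:R) *: ones R k) (c *: (ones R k)^T) (c * m%:R)%:M)
        (col_mx
          (c *: (ones R k *m (ones R m)^T *m invmx (Ymx R m) *m e_rest_cols m q))
          (c *: ((ones R m)^T *m invmx (Ymx R m) *m e_rest_cols m q)))
        0 0)].
Proof.
subst m n; rewrite !castmx_id => Pperm PLP c X.
have [Xu _] := invmx_block_diag1 k (Ymx_unit q).
split=> //; first exact: Ymx_unit.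
have -> : X *m P *m hub_matrix xi L *m P^T
          = X *m (P *m hub_matrix xi L *m P^T) by rewrite !mulmxA.
by rewrite hub_matrix_perm // PLP hub_matrix_block lumped_form.
Qed.

End Hub.

Theorem theorem3p1 (R : realType) (n k : nat) (k_ge1 : (1 <= k)%N)
    (kn : (k < n)%N) (L : 'M[R]_n) (L01 : is_adjacency L)
    (Lk : num_nondangling L = k)
    (xi : R) (xi_gt0 : 0 < xi) (xi_lt1 : xi < 1)
    (P : 'M[R]_n) (Pperm : is_perm_mx P)
    (L11 : 'M[R]_k) (L12 : 'M[R]_(k, n - k))
    (PLP : P *m L *m P^T =
       castmx (dangling_split kn, dangling_split kn) (block_mx L11 L12 0 0)) :
  [/\ Ymx R (n - k) \in unitmx,
      Xmx R kn \in unitmx,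
      Xmx R kn *m P *m hub_matrix xi L *m P^T *m invmx (Xmx R kn) =
        castmx (lumped_split kn, lumped_split kn)
          (block_mx (H1 xi L11 L12) (H2 n k xi) 0 0)
    & same_nonzero_eigenvalues (H1 xi L11 L12) (hub_matrix xi L)].
Proof.
have emq : (n - k = 1 + (n - k - 1))%N by rewrite subnKC // subn_gt0.
have [Yu Xu XHX] := hub_lumping (lumped_split kn) emq xi Pperm PLP.
split=> //.
have [Pu PV] := invmx_is_perm Pperm.
apply: (@same_nonzero_eigenvalues_char_poly _ _ _ (n - k - 1)).
rewrite -(char_poly_conjmx (hub_matrix xi L) Pu) -PV -(char_poly_conjmx _ Xu).
by rewrite !mulmxA XHX char_poly_castmx char_poly_block0.
Qed.
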